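(* Let $(M,\xi)$ be a contact manifold and let $\eta$ be a (local) choice of contact form for $\xi$, with Reeb vector field $\mathcal{R}$. Let $X$ be a contact vector field on $(M,\xi)$ and let $H=-\eta(X)$ be its Hamiltonian function. A point $x_0\in M$ (in the domain of $\eta$) is an equilibrium point of $X$ (i.e. $X(x_0)=0$) if and only if $$H(x_0)=0\quad\text{and}\quad \mathrm{d}H_{x_0}=-\tau\,\eta_{x_0}$$ for some $\tau\in\mathbb{R}$. In this case $\tau=-\mathcal{R}(H)(x_0)$.
   Context: All objects are smooth. A contact manifold $(M,\xi)$ is a manifold $M$ of dimension $2n+1$ with a rank-$2n$ subbundle $\xi\subset TM$ such that, for any (local) 1-form $\eta$ with $\ker\eta=\xi$ (called a contact form for $\xi$), $\eta\wedge(\mathrm{d}\eta)^n$ is nowhere zero. The Reeb vector field $\mathcal{R}$ of $\eta$ is the unique vector field with $\iota_{\mathcal{R}}\eta=1$ and $\iota_{\mathcal{R}}\mathrm{d}\eta=0$; $\mathcal{R}(H)=\mathrm{d}H(\mathcal{R})$. A contact vector field is a vector field $X$ whose flow preserves $\xi$, equivalently $L_X\eta=f\eta$ for some function $f$. Its Hamiltonian (with respect to $\eta$) is $H=-\eta(X)$, and one has $\iota_X\mathrm{d}\eta=\mathrm{d}H-\mathcal{R}(H)\eta$. *)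

(* Defs.v *)
From HB Require Import structures.
From mathcomp Require Import all_boot all_order all_algebra all_fingroup.
From mathcomp Require Import all_classical all_reals all_analysis.

Set Implicit Arguments.
Unset Strict Implicit.
Unset Printing Implicit Defensive.

Import Order.TTheory GRing.Theory Num.Theory.
Import numFieldNormedType.Exports.

Local Open Scope classical_set_scope.
Local Open Scope ring_scope.

(* C^k and C^oo maps on an open set.  'D_v f is the directional derivative, so
   the recursion runs over all iterated directional derivatives. *)
Fixpoint Ck_on (R : realType) (V W : normedModType R) (k : nat) (A : set V)
    (f : V -> W) : Prop :=
  match k with
  | 0 => forall y, A y -> {for y, continuous f}
  | k'.+1 => (forall y, A y -> differentiable f y) /\
             forall v : V, Ck_on k' A ('D_v f)
  end.

Definition smooth_map_on (R : realType) (V W : normedModType R) (A : set V)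
    (f : V -> W) : Prop :=
  forall k, Ck_on k A f.

(* chart_map and chart_inv are total functions; only their restrictions to
   chart_dom and to chart_map @` chart_dom are meaningful. *)
Record chart (R : realType) (T : topologicalType) (m : nat) := Chart {
  chart_dom : set T;
  chart_map :> T -> 'rV[R]_m;
  chart_inv : 'rV[R]_m -> T;
  chart_dom_open : open chart_dom;
  chart_cod_open : open (chart_map @` chart_dom);
  chart_mapK : forall x, chart_dom x -> chart_inv (chart_map x) = x;
  chart_map_cont : forall x, chart_dom x -> {for x, continuous chart_map};
  chart_inv_cont :
    forall y, (chart_map @` chart_dom) y -> {for y, continuous chart_inv} }.

Record manifold (R : realType) (m : nat) := Manifold {
  msort :> topologicalType;
  mhausdorff : hausdorff_space msort;
  msecond_countable : @second_countable msort;
  atlas : set (chart R msort m);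
  chart_at : msort -> chart R msort m;
  chart_at_atlas : forall x, atlas (chart_at x);
  chart_at_dom : forall x, chart_dom (chart_at x) x;
  atlas_compat : forall c c', atlas c -> atlas c' ->
    smooth_map_on (c @` (chart_dom c `&` chart_dom c')) (c' \o chart_inv c) }.

(* The tangent space T_xM is represented by the coordinate vectors in the
   distinguished chart chart_at x.  Hence a (not necessarily continuous) vector
   field, 1-form and field of subspaces are the following families; their
   coordinates in an arbitrary chart are obtained with the differentials of the
   transition maps between that chart and chart_at x. *)
Definition vfield (R : realType) (m : nat) (M : manifold R m) : Type :=
  M -> 'rV[R]_m.
Definition form1 (R : realType) (m : nat) (M : manifold R m) : Type :=
  M -> 'Hom('rV[R]_m, R^o).
Definition plane_field (R : realType) (m : nat) (M : manifold R m) : Type :=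
  M -> {vspace 'rV[R]_m}.

Section Calculus.
Context (R : realType) (m : nat) (M : manifold R m).
Implicit Types (c : chart R M m) (x : M) (U : set M).
Implicit Types (f : M -> R) (X : vfield M) (eta : form1 M).

Definition to_chart c x (v : 'rV[R]_m) : 'rV[R]_m :=
  'd (c \o chart_inv (chart_at x)) (chart_at x x) v.

Definition from_chart c x (v : 'rV[R]_m) : 'rV[R]_m :=
  'd (chart_at x \o chart_inv c) (c x) v.

Definition fun_in c f (y : 'rV[R]_m) : R^o := f (chart_inv c y).

Definition vfield_in c X (y : 'rV[R]_m) : 'rV[R]_m :=
  to_chart c (chart_inv c y) (X (chart_inv c y)).

(* The value at the point of coordinates y of eta on the constant coordinate
   vector field v of the chart c. *)
Definition form1_in c eta (v y : 'rV[R]_m) : R^o :=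
  eta (chart_inv c y) (from_chart c (chart_inv c y) v).

Definition smooth_fun_on U f : Prop :=
  forall c, atlas c -> smooth_map_on (c @` (U `&` chart_dom c)) (fun_in c f).

Definition smooth_vfield_on U X : Prop :=
  forall c, atlas c ->
    smooth_map_on (c @` (U `&` chart_dom c)) (vfield_in c X).

Definition smooth_form1_on U eta : Prop :=
  forall c, atlas c -> forall v,
    smooth_map_on (c @` (U `&` chart_dom c)) (form1_in c eta v).

(* The operators below are evaluated at x in the coordinates of chart_at x,
   which are those used to represent T_xM. *)
Definition dfun f x : 'Hom('rV[R]_m, R^o) :=
  linfun ('d (fun_in (chart_at x) f) (chart_at x x)).

(* d eta (u, v) = sum_ij (d_i eta_j - d_j eta_i) u_i v_j *)
Definition dform1 eta x (u v : 'rV[R]_m) : R :=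
  'D_u (form1_in (chart_at x) eta v) (chart_at x x)
  - 'D_v (form1_in (chart_at x) eta u) (chart_at x x).

(* (L_X eta)(v) = sum_ij (X_i (d_i eta_j) + eta_i (d_j X_i)) v_j *)
Definition lie_form1 X eta x (v : 'rV[R]_m) : R :=
  'D_(X x) (form1_in (chart_at x) eta v) (chart_at x x)
  + eta x ('D_v (vfield_in (chart_at x) X) (chart_at x x)).

End Calculus.

(* Exterior algebra of a vector space; p-covectors are functions of p vectors
   and the wedge product is normalised by 1 / (p! q!). *)
Section Exterior.
Context (R : realType) (V : Type).

Definition wedge_cov (p q : nat) (a : ('I_p -> V) -> R) (b : ('I_q -> V) -> R)
    (v : 'I_(p + q) -> V) : R :=
  (p`! * q`!)%:R^-1 *
  \sum_(s : 'S_(p + q)) (-1) ^+ s *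
     (a (fun i => v (s (lshift q i))) * b (fun j => v (s (rshift p j)))).

Definition covector1 (a : V -> R) (v : 'I_1 -> V) : R := a (v ord0).

Definition covector2 (b : V -> V -> R) (v : 'I_2 -> V) : R :=
  b (v ord0) (v ord_max).

Fixpoint wedge_pow (b : ('I_2 -> V) -> R) (n : nat) : ('I_(n.*2) -> V) -> R :=
  match n with
  | 0 => fun _ => 1
  | k.+1 => @wedge_cov 2 k.*2 b (@wedge_pow b k)
  end.

End Exterior.

Arguments wedge_pow {R V} b n v.

Section Contact.
Context (R : realType) (n : nat) (M : manifold R n.*2.+1).
Implicit Types (xi : plane_field M) (U : set M) (eta : form1 M).

Definition is_subbundle (r : nat) xi : Prop :=
  (forall x, \dim (xi x) = r) /\
  forall x, exists (U : set M) (Y : 'I_r -> vfield M),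
    [/\ open U, U x, (forall i, smooth_vfield_on U (Y i)) &
        forall y, U y -> xi y = <<[seq Y i y | i : 'I_r]>>%VS].

(* eta is a total family, but only its values on U matter. *)
Definition contact_form xi U eta : Prop :=
  [/\ open U, smooth_form1_on U eta & forall x, U x -> lker (eta x) = xi x].

Definition contact_structure xi : Prop :=
  is_subbundle n.*2 xi /\
  forall U eta, contact_form xi U eta -> forall x, U x ->
    exists v : 'I_(1 + n.*2) -> 'rV[R]_n.*2.+1,
      wedge_cov (covector1 (eta x))
        (wedge_pow (covector2 (dform1 eta x)) n) v != 0.

Definition reeb_field U eta (Rb : vfield M) : Prop :=
  smooth_vfield_on U Rb /\
  forall x, U x -> eta x (Rb x) = 1 /\ forall v, dform1 eta x (Rb x) v = 0.

(* The infinitesimal form of "the flow of X preserves xi": L_X eta = f eta for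
   every local contact form eta of xi. *)
Definition contact_vfield xi (X : vfield M) : Prop :=
  smooth_vfield_on setT X /\
  forall U eta, contact_form xi U eta ->
    exists f : M -> R, smooth_fun_on U f /\
      forall x, U x -> forall v, lie_form1 X eta x v = f x * eta x v.

Definition hamiltonian eta (X : vfield M) (x : M) : R := - eta x (X x).

End Contact.

(* Main.v *)
(** Cartan's formula [L_X eta = i_X d eta + d(eta(X))] with [L_X eta = f eta] and
    [H = - eta(X)] reads [i_X d eta = dH + f eta]. If [X] vanishes at [x0], so
    does [H], and [dH = - f eta] there. Conversely, if [H = 0] and
    [dH = - tau eta] at [x0], evaluating [i_X d eta = (f - tau) eta] on the Reeb
    field gives [f = tau], so [X] lies in the kernels of both [eta] and [d eta];
    it then kills [eta /\ (d eta)^n], a nonzero form of top degree, hence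
    [X = 0]. *)

Require Import Defs.
From HB Require Import structures.
From mathcomp Require Import all_boot all_order all_algebra all_fingroup.
From mathcomp Require Import all_classical all_reals all_analysis.
From mathcomp Require Import ring.

Set Implicit Arguments.
Unset Strict Implicit.
Unset Printing Implicit Defensive.

Import Order.TTheory GRing.Theory Num.Theory.
Import numFieldNormedType.Exports.
Local Open Scope classical_set_scope.
Local Open Scope ring_scope.

(** The first-order expansion of [g] at [x] is also one of [f], and by uniqueness its linear part
    ['d g x] is ['d f x]. *)
Lemma near_eq_differentiable (R : realType) (V W : normedModType R)
    (f g : V -> W) (x : V) :
  (\forall y \near x, f y = g y) -> differentiable g x -> differentiable f x.
Proof.
move=> fg dg.
have dg0 := differentiable_continuous dg.
have fgx : f x = g x := nbhs_singleton fg.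
have gc : continuous ('d g x) by exact: diff_continuous.
have exp : f \o shift x = cst (f x) + 'd g x +o_ 0 id.
  apply/eqaddoP => e e0.
  have := diff_locally dg => /eqaddoP /(_ e e0) Hg.
  have fg0 : \forall y \near 0, f (y + x) = g (y + x).
    by move: fg; rewrite (near_shift 0 x); apply: filterS => y /=; rewrite subr0.
  apply: filterS2 Hg fg0 => y /=; rewrite /= !fctE /= => + ->.
  by rewrite fgx.
apply/diff_locallyP; have fE := diff_unique gc exp.
by rewrite fE.
Qed.

(** * Charts and differentials of transition maps *)

Section Charts.
Context {R : realType} {m : nat} {M : manifold R m}.
Implicit Types (c : chart R M m) (x z : M) (U : set M).

(** Inside the open image of [c], this set is the preimage of [U] under [chart_inv c], which is
    continuous there. *)
Lemma chart_image_open c U : open U -> open (c @` (U `&` chart_dom c)).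
Proof.
move=> oU; rewrite openE => _ [z [Uz dz] <-].
have cz : (c @` chart_dom c) (c z) by exists z.
have nI : nbhs (c z) (chart_inv c @^-1` U).
  by apply: (chart_inv_cont cz); rewrite chart_mapK//; exact: open_nbhs_nbhs.
have nC : nbhs (c z) (c @` chart_dom c).
  by apply: open_nbhs_nbhs; split => //; exact: chart_cod_open.
rewrite /interior/=; apply: filterS (filterI nI nC) => _ [/[swap] -[w dw <-] Uy].
by exists w => //; split => //; rewrite -(chart_mapK dw).
Qed.

Lemma transition_differentiable c c' z : atlas c -> atlas c' ->
  chart_dom c z -> chart_dom c' z -> differentiable (c' \o chart_inv c) (c z).
Proof.
move=> ac ac' dz dz'; have [+ _] := atlas_compat ac ac' 1.
by apply; exists z.
Qed.

(** Chain rule. The composite of the two transition maps is the identity only on a neighbourhood of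
    [c z], so the comparison is made between directional derivatives, which depend only on germs. *)
Lemma diff_transitionK c c' z v : atlas c -> atlas c' ->
  chart_dom c z -> chart_dom c' z ->
  'd (c \o chart_inv c') (c' z) ('d (c' \o chart_inv c) (c z) v) = v.
Proof.
move=> ac ac' dz dz'.
have d1 := transition_differentiable ac ac' dz dz'.
have d2 := transition_differentiable ac' ac dz' dz.
have e : (c' \o chart_inv c) (c z) = c' z by rewrite /= chart_mapK.
rewrite -e in d2 *.
have := congr1 (fun h => h v) (diff_comp d1 d2) => /= <-.
rewrite -deriveE; last exact: differentiable_comp.
rewrite -[RHS](derive_id (c z)); apply: near_eq_derive.
have N : nbhs (c z) (c @` (chart_dom c' `&` chart_dom c)).
  apply: open_nbhs_nbhs; split; last by exists z.
  exact/chart_image_open/chart_dom_open.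
by apply: filterS N => _ [w [dw' dw] <-] /=; rewrite !chart_mapK.
Qed.

Lemma diff_chartK c z v : atlas c -> chart_dom c z ->
  'd (c \o chart_inv c) (c z) v = v.
Proof.
move=> ac dz; rewrite -deriveE; last exact: transition_differentiable.
rewrite -[RHS](derive_id (c z)); apply: near_eq_derive.
have N : nbhs (c z) (c @` chart_dom c).
  by apply: open_nbhs_nbhs; split; [exact: chart_cod_open|exists z].
by apply: filterS N => _ [w dw <-] /=; rewrite chart_mapK.
Qed.

End Charts.

Lemma derive_coord (R : realType) (V : normedModType R) (m n : nat)
    (f : V -> 'M[R]_(m, n)) (x v : V) i j :
  derivable f x v -> 'D_v (fun y => f y i j : R) x = ('D_v f x) i j.
Proof.
move=> df; apply/cvg_lim => //.
have := cvg_comp _ _ (df : cvg_to _ (nbhs ('D_v f x)))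
  (@coord_continuous R m n i j ('D_v f x)).
by apply: cvg_trans; apply: near_eq_cvg; near=> h; rewrite /= !mxE.
Unshelve. all: by end_near. Qed.

(** * Coordinate expressions of vector fields, 1-forms and the exterior derivative *)

Section LocalCoordinates.
Context {R : realType} {m : nat} {M : manifold R m}.
Implicit Types (c : chart R M m) (x z : M) (U : set M).
Implicit Types (X : vfield M) (eta : form1 M).

Lemma smooth_vfield_differentiable U X c z : smooth_vfield_on U X ->
  atlas c -> U z -> chart_dom c z -> differentiable (vfield_in c X) (c z).
Proof. by move=> sX ac Uz dz; have [+ _] := sX c ac 1; apply; exists z. Qed.

Lemma smooth_form1_differentiable U eta c v z : smooth_form1_on U eta ->
  atlas c -> U z -> chart_dom c z -> differentiable (form1_in c eta v) (c z).
Proof. by move=> se ac Uz dz; have [+ _] := se c ac v 1; apply; exists z. Qed.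

Lemma form1_in_linear c eta a u w :
  form1_in c eta (a *: u + w) = a *: form1_in c eta u + form1_in c eta w.
Proof.
by apply/funext => y; rewrite /form1_in /from_chart !fctE /= !linearP.
Qed.

Lemma form1_in_sum c eta v y :
  form1_in c eta v y = \sum_i v 0 i * form1_in c eta 'e_i y.
Proof.
rewrite {1}[v]row_sum_delta /form1_in /from_chart !linear_sum /=.
by apply: eq_bigr => i _; rewrite !linearZ.
Qed.

Lemma form1_in_chart_at eta x v :
  form1_in (chart_at x) eta v (chart_at x x) = eta x v.
Proof.
have dx := chart_at_dom x.
rewrite /form1_in chart_mapK // /from_chart diff_chartK //.
exact: chart_at_atlas.
Qed.

Lemma vfield_in_chart_at X x :
  vfield_in (chart_at x) X (chart_at x x) = X x.
Proof.
have dx := chart_at_dom x.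
rewrite /vfield_in chart_mapK // /to_chart diff_chartK //.
exact: chart_at_atlas.
Qed.

(** The pairing does not depend on the chart, as the differentials to and from [chart_at z] cancel.
    This allows one fixed chart for all points near [x], whose distinguished charts may differ. *)
Lemma form1_in_vfield c eta X z : atlas c -> chart_dom c z ->
  form1_in c eta (vfield_in c X (c z)) (c z) = eta z (X z).
Proof.
move=> ac dz; rewrite /form1_in /vfield_in chart_mapK //.
by rewrite /from_chart /to_chart diff_transitionK //;
  [exact: chart_at_atlas|exact: chart_at_dom].
Qed.

Lemma dform1_scalar_l U eta x v : smooth_form1_on U eta -> U x ->
  scalar (fun u => dform1 eta x u v).
Proof.
move=> se Ux a u w; rewrite /dform1.
have de y := smooth_form1_differentiable y se (chart_at_atlas x) Ux (chart_at_dom x).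
have L : 'D_(a *: u + w) (form1_in (chart_at x) eta v) (chart_at x x) =
    a * 'D_u (form1_in (chart_at x) eta v) (chart_at x x)
    + 'D_w (form1_in (chart_at x) eta v) (chart_at x x).
  by rewrite !(deriveE _ (de _)) linearP.
rewrite L form1_in_linear.
have dZ y : derivable (form1_in (chart_at x) eta y) (chart_at x x) v.
  exact: diff_derivable.
rewrite deriveD//; last exact: derivableZ.
by rewrite deriveZ// opprD addrACA mulrBr.
Qed.

Lemma dform1_antisym eta x u v : dform1 eta x u v = - dform1 eta x v u.
Proof. by rewrite /dform1 opprB. Qed.

Lemma dform1_scalar_r U eta x u : smooth_form1_on U eta -> U x ->
  scalar (dform1 eta x u).
Proof.
move=> se Ux a v w; rewrite !(dform1_antisym eta x u).
by rewrite (dform1_scalar_l _ se Ux) opprD mulrN.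
Qed.

End LocalCoordinates.

(* Leibniz rule for eta(X) = sum_i X_i eta_i in the chart at x. *)
Lemma dfun_hamiltonian (R : realType) (n : nat) (M : manifold R n.*2.+1)
    (U W : set M) (eta : form1 M) (X : vfield M) (x : M) v :
    smooth_form1_on U eta ->
    smooth_vfield_on W X -> U x -> W x ->
  dfun (hamiltonian eta X) x v =
    - (eta x ('D_v (vfield_in (chart_at x) X) (chart_at x x))
       + 'D_v (form1_in (chart_at x) eta (X x)) (chart_at x x)).
Proof.
move=> se sX Ux Wx; set c := chart_at x; set p := c x.
have ac : atlas c := chart_at_atlas x.
have dx : chart_dom c x := chart_at_dom x.
have de y : differentiable (form1_in c eta y) p.
  exact: smooth_form1_differentiable se ac Ux dx.
have dX : differentiable (vfield_in c X) p.
  exact: smooth_vfield_differentiable sX ac Wx dx.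
pose Xi i (y : 'rV[R]_n.*2.+1) : R := vfield_in c X y 0 i.
pose ei i : 'rV[R]_n.*2.+1 -> R := form1_in c eta 'e_i.
have dei i : differentiable (ei i) p by exact: de.
have dXi i : differentiable (Xi i) p.
  exact: differentiable_comp dX (differentiable_coord _ _ _).
(* Only the germ at [p] matters for [dfun], so the Hamiltonian may be replaced by its coordinate sum
   on the image of [c]. *)
have HE : \forall y \near p, fun_in c (hamiltonian eta X) y =
    (- \sum_i (Xi i * ei i)) y.
  have N : nbhs p (c @` chart_dom c).
    by apply: open_nbhs_nbhs; split; [exact: chart_cod_open|exists x].
  apply: filterS N => _ [z dz <-].
  rewrite /fun_in chart_mapK // /hamiltonian -(form1_in_vfield eta X ac dz).
  by rewrite form1_in_sum !fctE fct_sumE.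
have dP i : differentiable (Xi i * ei i) p by exact: differentiableM.
have dS : differentiable (\sum_i (Xi i * ei i)) p by exact: differentiable_sum.
have dH : differentiable (fun_in c (hamiltonian eta X)) p.
  exact: near_eq_differentiable HE (differentiableN dS).
rewrite /dfun lfunE /= -deriveE // (near_eq_derive _ HE).
have vd f : differentiable f p -> derivable f p v by exact: diff_derivable.
rewrite deriveN; last exact: diff_derivable.
rewrite derive_sum; last by move=> i; exact: diff_derivable.
congr (- _).
have -> : eta x ('D_v (vfield_in c X) p) = \sum_i 'D_v (Xi i) p * ei i p.
  rewrite -form1_in_chart_at form1_in_sum; apply: eq_bigr => i _.
  by congr (_ * _); rewrite derive_coord//; exact: diff_derivable.
(* Here the vector [X x] is frozen: its coordinates are constants, and only the [ei i] get
   differentiated. *)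
have -> : 'D_v (form1_in c eta (X x)) p = \sum_i Xi i p * 'D_v (ei i) p.
  have -> : form1_in c eta (X x) = \sum_i X x 0 i *: ei i.
    by apply/funext => y; rewrite form1_in_sum fct_sumE.
  rewrite derive_sum => [|i]; last by apply: derivableZ; exact: diff_derivable.
  apply: eq_bigr => i _; rewrite deriveZ; last exact: diff_derivable.
  by rewrite /Xi vfield_in_chart_at.
rewrite -big_split; apply: eq_bigr => i _ /=.
rewrite deriveM; [|exact: diff_derivable|exact: diff_derivable].
by rewrite addrC [ei i p *: _]mulrC.
Qed.

(** * Alternating multilinear forms and wedge products *)

Section Alternating.
Context {R : realType} {V : lmodType R}.

(** In [[eta v with j |-> u]] the word [eta] belongs to the notation for changing entry [j] of [v];
    no contact form is involved. *)
Definition multilinear k (F : ('I_k -> V) -> R) : Prop :=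
  forall v j a u w, F [eta v with j |-> a *: u + w] =
    a * F [eta v with j |-> u] + F [eta v with j |-> w].

Definition alternating k (F : ('I_k -> V) -> R) : Prop :=
  forall v i j, i != j -> v i = v j -> F v = 0.

(** The contraction of [F] with [x] is zero in every slot; asking this of all slots lets it pass to
    wedge products term by term. *)
Definition vanishes_at k (x : V) (F : ('I_k -> V) -> R) : Prop :=
  forall v j, v j = x -> F v = 0.

Lemma with_comp k l (v : 'I_l -> V) (g : 'I_k -> 'I_l) (i : 'I_k) (u : V) :
  injective g -> [eta v with g i |-> u] \o g = [eta v \o g with i |-> u].
Proof. by move=> gI; apply/funext => h /=; rewrite inj_eq. Qed.

Lemma with_comp_out k l (v : 'I_l -> V) (g : 'I_k -> 'I_l) (j : 'I_l) (u : V) :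
  (forall i, g i != j) -> [eta v with j |-> u] \o g = v \o g.
Proof. by move=> gj; apply/funext => h /=; rewrite (negPf (gj h)). Qed.

Section Wedge.
Context {p q : nat} (a : ('I_p -> V) -> R) (b : ('I_q -> V) -> R).

Lemma wedge_cov_multilinear :
  multilinear a -> multilinear b -> multilinear (wedge_cov a b).
Proof.
move=> ma mb v j c u w; rewrite /wedge_cov [in RHS]mulrCA -mulrDr; congr (_ * _).
rewrite mulr_sumr -big_split /=; apply: eq_bigr => s _.
rewrite [in RHS]mulrCA -[in RHS]mulrDr; congr (_ * _).
have lI : injective (s \o lshift q).
  by apply: inj_comp (@lshift_inj _ _); exact: perm_inj.
have rI : injective (s \o @rshift p q).
  by apply: inj_comp (@rshift_inj _ _); exact: perm_inj.
have lr h k : (s \o lshift q) h != (s \o @rshift p q) k.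
  by rewrite /= (inj_eq perm_inj) eq_lrshift.
have rl h k : (s \o @rshift p q) h != (s \o lshift q) k by rewrite eq_sym.
(* In the term of [s], slot [j] feeds exactly one argument, at position [s^-1 j]; the factor owning
   it is linear there and the other factor is unaffected. *)
have -> : j = s (s^-1 j)%g by rewrite permKV.
case: (split_ordP (s^-1 j)%g) => k ->.
- have L z := with_comp v k z lI; rewrite /comp/= in L.
  have Rr z := with_comp_out v z (rl ^~ k); rewrite /comp/= in Rr.
  by rewrite !Rr !L ma mulrDl mulrA.
- have L z := with_comp v k z rI; rewrite /comp/= in L.
  have Rr z := with_comp_out v z (lr ^~ k); rewrite /comp/= in Rr.
  by rewrite !Rr !L mb mulrDr mulrCA.
Qed.

Lemma wedge_cov_alternating : alternating (wedge_cov a b).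
Proof.
move=> v i j ij vij; rewrite /wedge_cov; set S := \sum_s _.
suff /eqP : S = - S.
  by rewrite -addr_eq0 -mulr2n mulrn_eq0 => /= /eqP ->; rewrite mulr0.
(* Composing [s] with the transposition of [i] and [j] keeps all arguments, since [v i = v j], and
   flips the sign. *)
rewrite {1}/S (reindex_inj (mulIg (tperm i j))) /= -sumrN; apply: eq_bigr => s _.
rewrite odd_permM odd_tperm ij addbT signrN mulNr.
have vt k : v (tperm i j k) = v k by case: tpermP => // ->.
by congr (- (_ * (a _ * b _))); apply/funext => k; rewrite permM vt.
Qed.

Lemma wedge_cov_vanishes_at x :
  vanishes_at x a -> vanishes_at x b -> vanishes_at x (wedge_cov a b).
Proof.
move=> xa xb v j vj; rewrite /wedge_cov big1 ?mulr0// => s _.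
have: v (s (s^-1 j)%g) = x by rewrite permKV.
case: (split_ordP (s^-1 j)%g) => k -> vk.
  by rewrite (xa _ k)// mul0r mulr0.
by rewrite (xb _ k)// !mulr0.
Qed.

End Wedge.

Lemma wedge_pow_multilinear (b : ('I_2 -> V) -> R) k :
  multilinear b -> multilinear (wedge_pow b k).
Proof.
move=> mb; elim: k => [v []//|k IH]; exact: (@wedge_cov_multilinear 2 k.*2 b _ mb IH).
Qed.

Lemma wedge_pow_vanishes_at x (b : ('I_2 -> V) -> R) k :
  vanishes_at x b -> vanishes_at x (wedge_pow b k).
Proof.
move=> xb; elim: k => [v []//|k IH]; exact: (@wedge_cov_vanishes_at 2 k.*2 b _ x xb IH).
Qed.

Lemma covector1_multilinear (a : V -> R) : scalar a -> multilinear (covector1 a).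
Proof. by move=> la v j c u w; rewrite (ord1 j) /covector1 /= la. Qed.

Lemma covector2_multilinear (b : V -> V -> R) :
  (forall u, scalar (b u)) -> (forall u, scalar (b ^~ u)) ->
  multilinear (covector2 b).
Proof.
move=> lb rb v j c u w; rewrite /covector2 /=.
by case: j => -[|[|//]] jlt /=; rewrite ?lb ?rb.
Qed.

End Alternating.

(* n vectors and x are linearly dependent in an n-dimensional space, and a
   relation expresses a multiple of one of the vectors by x and the others. *)
Lemma alternating_vanishes_at_eq0 (R : realType) (n : nat) (x : 'rV[R]_n)
    (F : ('I_n -> 'rV[R]_n) -> R) (v : 'I_n -> 'rV[R]_n) :
  multilinear F -> alternating F -> vanishes_at x F -> x != 0 -> F v = 0.
Proof.
move=> mF aF xF x0.
pose A := col_mx x (\matrix_i v i).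
(* [A] has n + 1 rows in an n-dimensional space, so its rows satisfy a nontrivial relation, with
   coefficients [a] on [x] and [c] on the [v i]. *)
have : kermx A != 0.
  by rewrite kermx_eq0 /row_free neq_ltn ltnS rank_leq_col.
move=> /rowV0Pn[w /sub_kermxP wA w0].
rewrite -(hsubmxK w) mul_row_col in wA w0.
set a := lsubmx w in wA w0; set c := rsubmx w in wA w0.
rewrite [a]mx11_scalar mul_scalar_mx mulmx_sum_row in wA.
(* Otherwise the relation reduces to [a] times [x] being zero with [a] nonzero, against [x != 0]. *)
have : c != 0.
  apply: contraNneq w0 => c0; move: wA; rewrite c0.
  rewrite big1 ?addr0 => [/eqP|i _]; last by rewrite mxE scale0r.
  by rewrite scaler_eq0 (negPf x0) orbF => /eqP a0; rewrite [a]mx11_scalar a0 raddf0 row_mx0.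
move=> /rV0Pn[j cj].
pose G u := F [eta v with j |-> u].
have GL d y z : G (d *: y + z) = d * G y + G z by exact: mF.
have G0 : G 0 = 0 by have := GL (-1) 0 0; rewrite scaler0 addr0 mulN1r addNr.
have Gx : G x = 0 by apply: (xF _ j); rewrite /= eqxx.
have Gv i : G (v i) = if i == j then F v else 0.
  rewrite /G; case: eqVneq => [->|ij].
    by congr F; apply/funext => h /=; case: eqVneq => // ->.
  by apply: (aF _ i j) => //=; rewrite (negPf ij) eqxx.
(* Applying [G] to the relation kills [x] and every [v i] with [i != j], leaving
   [c 0 j * F v = 0]. *)
have := G0; rewrite -[in G _]wA GL Gx mulr0 add0r.
suff -> : G (\sum_i c 0 i *: row i (\matrix_i v i)) = c 0 j * F v.
  by move=> /eqP; rewrite mulf_eq0 (negPf cj) => /eqP.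
transitivity (\sum_i c 0 i * G (v i)).
  by apply: (big_rec2 (fun y z => G y = z)) => // i y z _ <-; rewrite GL rowK.
by rewrite (bigD1 j) //= Gv eqxx big1 ?addr0 // => i ij; rewrite Gv (negPf ij) mulr0.
Qed.

(** * Cartan's formula, nondegeneracy and the equilibrium criterion *)

Lemma dform1_contact_vfield (R : realType) (n : nat) (M : manifold R n.*2.+1)
    (xi : plane_field M) (U : set M) (eta : form1 M) (X : vfield M) :
  contact_form xi U eta -> contact_vfield xi X ->
  exists f : M -> R, forall x, U x -> forall v,
    dform1 eta x (X x) v = dfun (hamiltonian eta X) x v + f x * eta x v.
Proof.
move=> ceta [sX /(_ U eta ceta)[f [_ Lf]]]; exists f => x Ux v.
have [_ se _] := ceta.
(* In coordinates, the terms with the derivative of [X] cancel between dH and the Lie derivative;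
   what remains is [dform1]. *)
rewrite (dfun_hamiltonian _ se sX Ux I) -Lf // /lie_form1 /dform1; ring.
Qed.

(** A nonzero such [w] would make the top-degree form in [contact_structure] vanish on every tuple,
    because both factors vanish as soon as one argument is [w]. *)
Lemma contact_structure_nondegenerate (R : realType) (n : nat)
    (M : manifold R n.*2.+1) (xi : plane_field M) (U : set M) (eta : form1 M)
    (x : M) (w : 'rV[R]_n.*2.+1) :
  contact_structure xi -> contact_form xi U eta -> U x ->
  eta x w = 0 -> (forall v, dform1 eta x w v = 0) -> w = 0.
Proof.
move=> [_ cs] ceta Ux ew dw; apply/eqP/negPn/negP => w0.
have [v /eqP[]] := cs U eta ceta x Ux; have [_ se _] := ceta.
have m1 : multilinear (covector1 (eta x)).
  by apply: covector1_multilinear => a u z; rewrite linearP.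
have m2 : multilinear (covector2 (dform1 eta x)).
  apply: covector2_multilinear => u; first exact: dform1_scalar_r se Ux.
  exact: dform1_scalar_l se Ux.
have v1 : vanishes_at w (covector1 (eta x)).
  by move=> y j; rewrite (ord1 j) /covector1 => ->.
have v2 : vanishes_at w (covector2 (dform1 eta x)).
  move=> y [[|[|//]] jlt] e; rewrite /covector2.
    by rewrite (_ : ord0 = Ordinal jlt) ?e//; exact: val_inj.
  rewrite (_ : ord_max = Ordinal jlt) ?e; last exact: val_inj.
  by rewrite dform1_antisym dw oppr0.
have m3 := wedge_pow_multilinear (k := n) m2.
have v3 := wedge_pow_vanishes_at (k := n) v2.
exact: alternating_vanishes_at_eq0 (wedge_cov_multilinear m1 m3)
  (@wedge_cov_alternating _ _ 1 n.*2 _ _) (wedge_cov_vanishes_at v1 v3) w0.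
Qed.

Theorem proposition2p1 (R : realType) (n : nat) (M : manifold R n.*2.+1)
    (xi : plane_field M) (hxi : contact_structure xi)
    (U : set M) (eta : form1 M) (heta : contact_form xi U eta)
    (Rb : vfield M) (hRb : reeb_field U eta Rb)
    (X : vfield M) (hX : contact_vfield xi X)
    (x0 : M) (hx0 : U x0) :
  (X x0 = 0 <->
     hamiltonian eta X x0 = 0 /\
     exists tau : R, dfun (hamiltonian eta X) x0 = - tau *: eta x0) /\
  (X x0 = 0 -> forall tau : R,
     dfun (hamiltonian eta X) x0 = - tau *: eta x0 ->
     tau = - dfun (hamiltonian eta X) x0 (Rb x0)).
Proof.
have [_ se _] := heta.
have [_ /(_ x0 hx0)[etaR dR]] := hRb.
have [f /(_ x0 hx0) cartan] := dform1_contact_vfield heta hX.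
(* The value of [tau] comes from evaluating dH on the Reeb field, where [eta] is 1. *)
split; last by move=> _ tau ->; rewrite scale_lfunE etaR [- tau *: _]mulr1 opprK.
split=> [X0|[H0 [tau dH]]].
  split; first by rewrite /hamiltonian X0 linear0 oppr0.
  (* With [X x0 = 0], Cartan's formula becomes 0 = dH + f eta, so the conformal factor is the
     witness. *)
  exists (f x0); apply/lfunP => v; rewrite scale_lfunE.
  have dX0 : dform1 eta x0 (X x0) v = 0.
    have := dform1_scalar_l v se hx0 (-1) 0 0.
    by rewrite X0 scaler0 addr0 mulN1r addNr.
  have := cartan v; rewrite dX0 => /esym/eqP; rewrite addr_eq0 => /eqP ->.
  by rewrite -mulNr.
have etaX : eta x0 (X x0) = 0 by apply/eqP; rewrite -oppr_eq0; exact/eqP.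
have dX v : dform1 eta x0 (X x0) v = (f x0 - tau) * eta x0 v.
  by rewrite cartan dH scale_lfunE /GRing.scale/=; ring.
(* On the Reeb field the left side of [dX] is zero and [eta] is 1. *)
have ftau : f x0 - tau = 0.
  by have := dX (Rb x0); rewrite dform1_antisym dR oppr0 etaR mulr1.
apply: (contact_structure_nondegenerate hxi heta hx0 etaX) => v.
by rewrite dX ftau mul0r.
Qed.
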